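(* For every $k\ge 2$, rumor spreading in the complete graph on $n$ nodes with the $k$-PUSH&PULL protocol requires $O(\log_k n)$ rounds with high probability.
   Context: The $k$-PUSH&PULL protocol on a graph: initially one arbitrary node knows a rumor (is informed). The process proceeds in synchronous rounds. In each round every node independently samples $k$ of its neighbors uniformly at random with replacement; every informed node sends the rumor to all the neighbors it sampled (push), and, simultaneously, every uninformed node requests the rumor from all the neighbors it sampled and becomes informed if at least one of them was informed at the start of the round (pull). Informed nodes stay informed. Rumor spreading is completed when all nodes are informed; the number of rounds required is the first round after which this holds. The number $k$ may depend on $n$. A statement holds with high probability (w.h.p.) if it holds with probability at least $1-n^{-c}$, where $c>0$ is a constant hidden in the asymptotic notation (i.e. for every constant $c>0$ the statement holds with probability at least $1-n^{-c}$ for a suitable implied constant depending only on $c$, in particular not on $k$).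
   Formalization: The bound is read as C·log_k n rounded up to an integer, since for k larger than n^C the quantity C·log_k n is below 1 while at least one round is always needed; n ≥ 2 is assumed so that nodes have neighbors. *)

(* Defs.v *)
From HB Require Import structures.
From mathcomp Require Import all_boot all_order all_algebra finmap.
From mathcomp Require Import all_classical all_reals all_analysis.

Set Implicit Arguments.
Unset Strict Implicit.
Unset Printing Implicit Defensive.
Import Order.TTheory GRing.Theory Num.Theory.

Local Open Scope classical_set_scope.
Local Open Scope ring_scope.

Definition complete_graph (V : finType) : rel V := [rel u v | u != v].

Section Protocol.
Variables (V : finType) (k : nat).

(* [smp u i] is the [i]-th neighbor sampled by node [u] in the current round.
   Pulls by nodes that are already informed change nothing, so the third
   disjunct need not be restricted to uninformed [v]. *)
Definition push_pull_round (smp : V -> 'I_k -> V) (I : {set V}) : {set V} :=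
  [set v : V | [|| v \in I,
                   [exists u in I, exists i, smp u i == v] |
                   [exists i, smp v i \in I]]]%SET.

(* [smp t u i] is the [i]-th neighbor sampled by [u] in round [t + 1];
   [informed smp s t] is the set of informed nodes after [t] rounds. *)
Fixpoint informed (smp : nat -> V -> 'I_k -> V) (s : V) (t : nat) : {set V} :=
  if t is t'.+1 then push_pull_round (smp t') (informed smp s t')
  else [set s]%SET.

(* First round after which every node is informed, [+oo] if there is none. *)
Definition spreading_time (R : realType) (smp : nat -> V -> 'I_k -> V) (s : V)
    : \bar R :=
  ereal_inf [set t%:R%:E | t in [set t | informed smp s t = [set: V]%SET]].

End Protocol.

Section Randomness.
Context (R : realType) (d : measure_display) (Omega : measurableType d).
Variable P : probability Omega R.

(* Random variables with values in [V], equipped with the discrete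
   sigma-algebra; their joint law is the product over each finite subfamily. *)
Definition mutually_independent (J : choiceType) (V : Type)
    (X : J -> Omega -> V) : Prop :=
  forall (F : {fset J}) (B : J -> set V),
    P (\bigcap_(j in [set` F]) X j @^-1` B j) =
    (\prod_(j <- F) P (X j @^-1` B j))%E.

Definition uniform_on (V : finType) (A : {set V}) (Y : Omega -> V) : Prop :=
  forall v : V,
    P (Y @^-1` [set v]) = (if v \in A then #|A|%:R^-1 else 0)%:E.

(* In every round every node samples [k] neighbors uniformly at random with
   replacement; all samples, over all rounds and nodes, are independent. *)
Record neighbor_samples (V : finType) (e : rel V) (k : nat)
    (X : nat -> V -> 'I_k -> Omega -> V) : Prop := NeighborSamples {
  samples_measurable :
    forall t u i (B : set V), measurable (X t u i @^-1` B);
  samples_uniform :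
    forall t u i, uniform_on [set v : V | e u v]%SET (X t u i);
  samples_independent :
    mutually_independent (fun j : nat * V * 'I_k => X j.1.1 j.1.2 j.2)
}.

End Randomness.

(* Main.v *)
(* Only pulls are used.  Call I the informed set, i = |I|, u = n - i, and take
   the potential Phi(I) = u / i.  An uninformed node pulls the rumor with
   probability p = 1 - r^k, r = (u - 1) / (n - 1), independently of the other
   ones, so B ~ Bin(u, p) nodes pull it and the new potential is at most
   (u - B) / (i + B).  Since (u - j) C(u, j) = (j + 1) C(u, j + 1), its mean is
   at most (1 - p) / p, and comparing 1 - r^k = (1 - r)(1 + ... + r^(k-1)) with
   k (1 - r) r^(k-1) bounds this by (u - 1) / (i k) <= Phi(I) / k.  Hence
   E Phi <= (n - 1) / k^t after t rounds; as Phi >= 1 / n before completion,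
   Markov's inequality gives failure probability at most n (n - 1) / k^t, which
   is at most n^(-c) once t >= (2 + c) log_k n. *)

Require Import Defs.
From HB Require Import structures.
From mathcomp Require Import all_boot all_order all_algebra finmap.
From mathcomp Require Import all_classical all_reals all_analysis.
From mathcomp Require Import ring zify.

Set Implicit Arguments.
Unset Strict Implicit.
Unset Printing Implicit Defensive.
Import Order.TTheory GRing.Theory Num.Theory.

Local Open Scope classical_set_scope.
Local Open Scope ring_scope.

(** * Binomial and geometric estimates *)

(** As [i >= 1], the denominator [i + j] may be lowered to [j + 1]. Each term then equals [q / p]
    times the binomial term of index [j + 1], and those terms sum to at most 1. *)
Lemma binomial_ratio_le (R : realFieldType) (p q : R) (i u : nat) :
  (0 < i)%N -> 0 < p -> 0 <= q -> p + q = 1 ->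
  \sum_(j < u.+1) (p ^+ j * q ^+ (u - j) *+ 'C(u, j)) *
    ((u - j)%:R / (i + j)%:R) <= q / p.
Proof.
move=> i_gt0 p_gt0 q_ge0 pq1.
have termE j : (j < u)%N ->
    (p ^+ j * q ^+ (u - j) *+ 'C(u, j)) * ((u - j)%:R / j.+1%:R) =
    q / p * (q ^+ (u - j.+1) * p ^+ j.+1 *+ 'C(u, j.+1)).
  move=> ju; rewrite -(subnSK ju) exprS [p ^+ j.+1]exprS.
  rewrite -[_ *+ 'C(u, j)]mulr_natr -[_ *+ 'C(u, j.+1)]mulr_natr.
  have : (j.+1%:R * 'C(u, j.+1)%:R = (u - j.+1).+1%:R * 'C(u, j)%:R :> R).
    by rewrite -!natrM mul_bin_left subnSK.
  have : (j.+1%:R : R) != 0 by rewrite pnatr_eq0.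
  have : p != 0 by rewrite gt_eqF.
  move: (j.+1%:R : R) ('C(u, j.+1)%:R : R) ((u - j.+1).+1%:R : R) ('C(u, j)%:R : R)
    (p ^+ j) (q ^+ _) => a b x y P Q p0 a0 abE.
  have -> : b = x * y / a by rewrite -abE mulrC mulKf.
  by field; rewrite p0 a0.
have le1 : \sum_(j < u) (q ^+ (u - j.+1) * p ^+ j.+1 *+ 'C(u, j.+1)) <= 1.
  rewrite -[leRHS](expr1n R u) -pq1 addrC exprDn big_ord_recl /= lerDr.
  by rewrite mulrn_wge0// mulr_ge0// exprn_ge0// ltW.
rewrite big_ord_recr /= subnn mul0r mulr0 addr0.
have qp_ge0 : 0 <= q / p by rewrite divr_ge0// ltW.
rewrite -[leRHS]mulr1; apply: le_trans (ler_wpM2l qp_ge0 le1).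
rewrite mulr_sumr; apply: ler_sum => j _; rewrite -termE//.
apply: ler_wpM2l; first by rewrite mulrn_wge0// mulr_ge0// exprn_ge0// ltW.
apply: ler_wpM2l => //; rewrite lef_pV2 ?posrE ?ltr0n ?addn_gt0 ?i_gt0//.
by rewrite ler_nat -add1n leq_add2r.
Qed.

(** After cancelling [1 - r], the right side is the sum of the powers [r ^+ i.+1] for [i < k], each
    at least [r ^+ k]. *)
Lemma geometric_ratio_le (R : realFieldType) (r : R) (k : nat) :
  0 <= r -> r < 1 -> k%:R * (1 - r) * r ^+ k <= r * (1 - r ^+ k).
Proof.
move=> r_ge0 r_lt1; have -> : 1 - r ^+ k = (1 - r) * \sum_(i < k) r ^+ i.
  by rewrite -[LHS]opprB subrX1 -mulNr opprB.
rewrite mulrAC [leRHS]mulrCA [leRHS]mulrC ler_pM2r ?subr_gt0//.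
rewrite mulr_sumr mulr_natl -[X in _ *+ X]card_ord -sumr_const.
apply: ler_sum => i _; rewrite -exprS.
by apply: ler_wiXn2l => //; apply: ltW.
Qed.

Lemma sum_subset_card (R : nmodType) (T : finType) (U : {set T}) (f : nat -> R) :
  \sum_(W : {set T} | W \subset U) f #|W| =
  \sum_(j < #|U|.+1) f j *+ 'C(#|U|, j).
Proof.
rewrite (partition_big (fun W : {set T} => inord #|W| : 'I_#|U|.+1) xpredT)//=.
apply: eq_bigr => j _.
rewrite (eq_bigl [in [set A : {set T} | A \subset U & #|A| == j]]); last first.
  move=> W; rewrite !inE; case: (boolP (W \subset U)) => //= WU.
  by rewrite -val_eqE /= inordK// ltnS subset_leq_card.
rewrite (eq_bigr (fun=> f j)); last by move=> W; rewrite !inE => /andP[_ /eqP->].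
by rewrite sumr_const cards_draws.
Qed.

(** * One round: law of the pulls and contraction of the potential *)

Section OneRound.
Context (R : realFieldType) (V : finType) (k : nat).
Implicit Types (I W J : {set V}) (v x : V).

(** Shaped like the right side of [uniform_on], so that uniformity of the samples applies to it by
    conversion. *)
Definition sample_weight v x : R :=
  if x \in [set y | complete_graph v y]%SET
  then #|[set y | complete_graph v y]%SET|%:R^-1 else 0.

(** By independence, the probability that [h] is the table of all samples of a round. *)
Definition round_weight (h : {ffun V -> {ffun 'I_k -> V}}) : R :=
  \prod_v \prod_i sample_weight v (h v i).

Definition pulled (h : {ffun V -> {ffun 'I_k -> V}}) I : {set V} :=
  [set v in ~: I | [exists i, h v i \in I]]%SET.

(* Equal to [0] at [I = set0] since [0^-1 = 0], so that the contraction below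
   also holds there. *)
Definition uninformed_ratio I : R := #|~: I|%:R / #|I|%:R.

Lemma card_neighbors v : #|[set y | complete_graph v y]%SET| = #|V|.-1.
Proof.
rewrite -[in RHS]cardsT [in RHS](cardsD1 v) inE add1n /=; apply: eq_card => y.
by rewrite !inE andbT eq_sym.
Qed.

Lemma sample_weight_ge0 v x : 0 <= sample_weight v x.
Proof. by rewrite /sample_weight; case: ifP. Qed.

Lemma round_weight_ge0 h : 0 <= round_weight h.
Proof. by do 2 (apply: prodr_ge0 => ? _); exact: sample_weight_ge0. Qed.

Lemma sum_sample_weight v (A : {set V}) :
  \sum_(x in A) sample_weight v x = #|A :\ v|%:R / #|V|.-1%:R.
Proof.
rewrite /sample_weight -big_mkcondr /= card_neighbors.
rewrite (eq_bigl [in (A :\ v)%SET]); first by rewrite sumr_const mulr_natl.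
by move=> x; rewrite !inE eq_sym andbC.
Qed.

(** The probability that all pulls of an uninformed [v] fail. The predecessor of [#|~: I|] appears
    because [v] is uninformed but not its own neighbor. *)
Lemma prod_sample_weight_avoid v I : v \notin I ->
  \sum_(a : {ffun 'I_k -> V} | [forall i, a i \notin I])
     \prod_i sample_weight v (a i) =
  ((#|~: I|.-1)%:R / #|V|.-1%:R) ^+ k.
Proof.
move=> vI; rewrite (eq_bigl [in family (fun=> [in ~: I]%SET)]); last first.
  by move=> a; apply/forallP/familyP => aI i; move: (aI i); rewrite !inE.
rewrite -(bigA_distr_big_dep _ (fun _ x => sample_weight v x)).
rewrite prodr_const card_ord sum_sample_weight.
by rewrite (cardsD1 v (~: I)%SET) !inE vI.
Qed.

Lemma sum_prod_sample_weight v : (1 < #|V|)%N ->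
  \sum_(a : {ffun 'I_k -> V}) \prod_i sample_weight v (a i) = 1.
Proof.
move=> V1; rewrite -(bigA_distr_bigA (fun _ x => sample_weight v x)).
rewrite big1// => i _; rewrite (eq_bigl [in [set: V]%SET]); last first.
  by move=> x; rewrite inE.
rewrite sum_sample_weight -[#|V| in X in _ / X]cardsT (cardsD1 v [set: V]%SET).
rewrite inE add1n divff// pnatr_eq0 -lt0n.
by move: V1; rewrite -cardsT (cardsD1 v) inE.
Qed.

(** The condition [pulled h I == W] splits into one condition per node, so the sum factors: 1 for a
    node of [I], [1 - q] for a node of [W], [q] for any other. *)
Lemma sum_round_weight_pulled I W : (1 < #|V|)%N -> W \subset (~: I)%SET ->
  let q := ((#|~: I|.-1)%:R / #|V|.-1%:R) ^+ k in
  \sum_(h | pulled h I == W) round_weight h =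
  (1 - q) ^+ #|W| * q ^+ (#|~: I| - #|W|).
Proof.
move=> V1 /fintype.subsetP WI q.
pose ok v (a : {ffun 'I_k -> V}) :=
  (v \in I) || ((v \in W) == [exists i, a i \in I]).
rewrite (eq_bigl [in family ok]); last first.
  move=> h; apply/eqP/familyP => [hW v|hW].
    rewrite -[_ \in _]/(ok v (h v)) /ok -hW !inE.
    by case: (v \in I) => //=.
  apply/setP => v; have : ok v (h v) := hW v.
  have := WI v; rewrite !inE /ok; case: (v \in I) => /= [WvF _|_ /eqP//].
  by apply/esym/negP => /WvF.
rewrite -(bigA_distr_big_dep ok (fun v a => \prod_i sample_weight v (a i))).
have okE v : \sum_(a | ok v a) \prod_i sample_weight v (a i) =
    if v \in I then 1 else if v \in W then 1 - q else q.
  rewrite /ok; case: ifPn => [vI|vI] /=; first exact: sum_prod_sample_weight.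
  case: ifPn => vW /=.
    have := sum_prod_sample_weight v V1.
    rewrite (bigID (fun a : {ffun 'I_k -> V} => [exists i, a i \in I])) /=.
    under [X in _ + X]eq_bigl do rewrite negb_exists.
    rewrite (prod_sample_weight_avoid vI) => /(canRL (addrK _)) <-.
    by apply: eq_bigl => a; rewrite eq_sym eqb_id.
  rewrite /q -(prod_sample_weight_avoid vI); apply: eq_bigl => a.
  by rewrite eq_sym eqbF_neg negb_exists.
rewrite (eq_bigr _ (fun v _ => okE v)).
rewrite (bigID [in W]) /=; congr *%R.
  rewrite -prodr_const; apply: eq_bigr => v vW; rewrite vW.
  by have := WI v vW; rewrite inE => /negPf->.
have -> : (#|~: I| - #|W| = #|(~: I) :\: W|)%N.
  by rewrite cardsD (finset.setIidPr _)//; apply/fintype.subsetP.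
rewrite -prodr_const big_mkcond [RHS]big_mkcond /=; apply: eq_bigr => v _.
by rewrite !inE; case: (v \in W); case: (v \in I).
Qed.

Lemma pulled_round_subset (h : {ffun V -> {ffun 'I_k -> V}}) I :
  (I :|: pulled h I)%SET \subset push_pull_round (fun v i => h v i) I.
Proof.
apply/fintype.subsetP => v; rewrite !inE => /orP[->//|/andP[_ ->]].
by rewrite !orbT.
Qed.

(** The potential decreases as the informed set grows, so nodes of [J] informed by pushes alone can
    be ignored. *)
Lemma uninformed_ratio_le I W J : (0 < #|I|)%N -> W \subset (~: I)%SET ->
  (I :|: W)%SET \subset J ->
  uninformed_ratio J <= (#|~: I| - #|W|)%:R / (#|I| + #|W|)%:R.
Proof.
move=> I_gt0 WI IWJ; have IW0 : I :&: W = finset.set0.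
  apply/setP => v; rewrite !inE; apply/negbTE/negP => /andP[vI].
  by move/(fintype.subsetP WI); rewrite inE vI.
have cIW : #|I :|: W|%SET = (#|I| + #|W|)%N by rewrite cardsU IW0 cards0 subn0.
have IW_gt0 : (0 < #|I| + #|W|)%N by rewrite addn_gt0 I_gt0.
have leJ : (#|I| + #|W| <= #|J|)%N by rewrite -cIW subset_leq_card.
have leC : (#|~: J| <= #|~: I| - #|W|)%N.
  by have := cardsC I; have := cardsC J; move: leJ; lia.
apply: ler_pM; rewrite ?invr_ge0 ?ler0n ?ler_nat//.
rewrite lef_pV2 ?posrE ?ltr0n ?ler_nat//; exact: leq_trans leJ.
Qed.

Lemma sum_round_uninformed_ratio_le I : (1 < #|V|)%N -> (0 < k)%N ->
  \sum_h round_weight h * uninformed_ratio (push_pull_round (fun v i => h v i) I)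
    <= uninformed_ratio I / k%:R.
Proof.
move=> V1 k_gt0; have [I0|I_gt0] := posnP #|I|.
  have round0 h : push_pull_round (fun v i => h v i) I = finset.set0.
    rewrite (cards0_eq I0); apply/setP => v; rewrite !inE /=.
    apply/negbTE; rewrite negb_or; apply/andP; split.
      by apply/existsP => -[u]; rewrite inE.
    by apply/existsP => -[i]; rewrite inE.
  rewrite /uninformed_ratio I0 invr0 mulr0 mul0r big1// => h _.
  by rewrite round0 cards0 invr0 !mulr0.
set u := #|~: I|; set m : R := #|V|.-1%:R.
set r : R := u.-1%:R / m; set q := r ^+ k.
have m_gt0 : 0 < m by rewrite ltr0n -subn1 subn_gt0.
have r_ge0 : 0 <= r by rewrite divr_ge0.
have iuV : (#|I| + u = #|V|)%N by rewrite cardsC.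
have r_lt1 : r < 1.
  rewrite ltr_pdivrMr// mul1r ltr_nat; move: V1 I_gt0; rewrite -iuV; lia.
have q_ge0 : 0 <= q by rewrite exprn_ge0.
have p_gt0 : 0 < 1 - q by rewrite subr_gt0 exprn_ilt1// lt0n_neq0.
pose f j : R := (1 - q) ^+ j * q ^+ (u - j) * ((u - j)%:R / (#|I| + j)%:R).
(* Tables are grouped by the pulled set; the resulting bound depends only on its size and becomes a
   binomial mean. *)
apply: (@le_trans _ _ (\sum_(W : {set V} | W \subset (~: I)%SET) f #|W|)).
  rewrite (partition_big (pulled ^~ I) (fun W => W \subset (~: I)%SET)) /=; last first.
    by move=> h _; apply/fintype.subsetP => v; rewrite !inE => /andP[].
  apply: ler_sum => W WI.
  rewrite /f -(sum_round_weight_pulled V1 WI) mulr_suml.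
  apply: ler_sum => h /eqP hW; apply: ler_wpM2l (round_weight_ge0 h) _ _ _.
  by apply: uninformed_ratio_le => //; rewrite -hW pulled_round_subset.
rewrite sum_subset_card.
under eq_bigr do rewrite /f -mulrnAl.
apply: le_trans (binomial_ratio_le _ I_gt0 p_gt0 q_ge0 _) _; first by rewrite subrK.
(* The case [u = 0] is separate because [u.-1] truncates there and [1 - r = #|I| / m] fails. *)
have [u0|u_gt0] := posnP u.
  rewrite /uninformed_ratio -/u u0 /q /r u0 !mul0r expr0n gtn_eqF// !mul0r//.
have r1E : 1 - r = #|I|%:R / m.
  have -> : #|I|%:R = m - u.-1%:R :> R.
    by rewrite -natrB; [congr _%:R|]; move: V1 I_gt0; rewrite -iuV; lia.
  by rewrite mulrBl divff// gt_eqF.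
have := geometric_ratio_le k r_ge0 r_lt1; rewrite -/q r1E => H.
rewrite ler_pdivrMr// /uninformed_ratio -/u.
have i0 : (0 : R) < #|I|%:R by rewrite ltr0n.
have k0 : (0 : R) < k%:R by rewrite ltr0n.
rewrite -[_ / _ / _]mulrA -invfM mulrAC ler_pdivlMr ?mulr_gt0//.
(* The geometric estimate multiplied by [m] reads [k * #|I| * q <= u.-1 * (1 - q)]. *)
apply: (@le_trans _ _ (u.-1%:R * (1 - q))).
  rewrite -(ler_pM2r (_ : 0 < m^-1)) ?invr_gt0//.
  by move: H; rewrite /r; congr (_ <= _); ring.
by apply: ler_wpM2r; [exact: ltW|rewrite ler_nat leq_pred].
Qed.

End OneRound.


(** * Law of the informed set on the probability space *)

Lemma probability_finType_bigcup d (T : measurableType d) (R : realType)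
    (P : probability T R) (J : finType) (Q : pred J) (F : J -> set T) :
  (forall j, Q j -> measurable (F j)) ->
  (forall i j w, Q i -> Q j -> F i w -> F j w -> i = j) ->
  P (\bigcup_(j in [set j | Q j]) F j) = (\sum_(j | Q j) P (F j))%E.
Proof.
move=> mF Finj; rewrite measure_fin_bigcup; last first.
- by move=> j /mF.
- apply/trivIsetP => i j Qi Qj; apply: contra_neqP => /eqP/set0P[w [Fi Fj]].
  exact: Finj Fi Fj.
- exact: finite_finset.
rewrite -[RHS]big_filter [RHS]fsbig_seq ?filter_uniq ?index_enum_uniq//.
rewrite (_ : [set j | Q j] = [set` [seq j <- index_enum J | Q j]])//.
apply/seteqP; split=> j /=; rewrite mem_filter mem_index_enum.
  by move=> ->.
by move=> /andP[].
Qed.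

Section Protocol.
Context (R : realType) (d : measure_display) (Omega : measurableType d).
Context (P : probability Omega R) (V : finType) (k : nat).
Context (X : nat -> V -> 'I_k -> Omega -> V) (s : V).
Hypothesis X_samples : neighbor_samples P (@complete_graph V) X.

Let round_samples := {ffun V -> {ffun 'I_k -> V}}.
Implicit Types (g : nat -> round_samples) (h : round_samples) (I J : {set V}).

Let informed_at t w := informed (fun t u i => X t u i w) s t.

(** A cylinder event on rounds [t] to [T - 1]. The moving left end lets an induction on [t] separate
    the past state from future samples. *)
Definition samples_agree t T g : set Omega :=
  [set w | forall tau, (t <= tau < T)%N -> forall v i, X tau v i w = g tau v i].

Lemma samples_agree_bigcap t T g : samples_agree t T g =
  \bigcap_(j in [set j : nat * V * 'I_k | (t <= j.1.1 < T)%N])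
    X j.1.1 j.1.2 j.2 @^-1` [set g j.1.1 j.1.2 j.2].
Proof.
apply/seteqP; split=> [w Xg [[tau v] i] /= tauT|w Xg tau tauT v i]; first exact: Xg.
exact: (Xg (tau, v, i)).
Qed.

(** Independence is assumed over finite sets of indices, so the samples of the first [T] rounds are
    listed as such a set. *)
Let embed T (j : 'I_T * V * 'I_k) : nat * V * 'I_k := (val j.1.1, j.1.2, j.2).

Let indices T : {fset nat * V * 'I_k} := seq_fset tt (map (@embed T) (enum predT)).

Lemma indicesE T : [set` indices T] = [set j | (0 <= j.1.1 < T)%N].
Proof.
apply/seteqP; split=> [[[tau v] i]|[[tau v] i]] /=; rewrite seq_fsetE.
  by move=> /mapP[[[a b] c] _ [-> _ _]] /=.
by move=> tauT; apply/mapP; exists (Ordinal tauT, v, i); rewrite ?mem_enum.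
Qed.

Lemma measurable_samples_agree t T g : measurable (samples_agree t T g).
Proof.
rewrite samples_agree_bigcap; apply: fin_bigcap_measurable => [|j _].
  apply: sub_finite_set (finite_fset (indices T)); rewrite indicesE.
  by move=> j /= /andP[_ ->].
exact: samples_measurable X_samples _ _ _ _.
Qed.

Lemma prob_samples_agree T g :
  P (samples_agree 0 T g) = (\prod_(0 <= tau < T) round_weight R (g tau))%:E.
Proof.
rewrite samples_agree_bigcap -indicesE.
rewrite (samples_independent X_samples _ (fun j => [set g j.1.1 j.1.2 j.2])).
rewrite (eq_bigr (fun j => (sample_weight R j.1.2 (g j.1.1 j.1.2 j.2))%:E)).
  2: by move=> j _; exact: samples_uniform X_samples _ _ _ _.
rewrite prodEFin; congr EFin.
rewrite (perm_big (map (@embed T) (enum predT))); last first.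
  apply: uniq_perm; first exact: fset_uniq.
    rewrite map_inj_uniq ?enum_uniq// => -[[a b] c] [[a' b'] c'] [].
    by move=> /val_inj-> -> ->.
  exact: seq_fsetE.
rewrite big_map big_enum /= big_mkord.
rewrite (eq_bigr (fun j : 'I_T * V * 'I_k =>
  sample_weight R j.1.2 (g j.1.1 j.1.2 j.2)))//.
rewrite -(pair_bigA _ (fun (a : 'I_T * V) i => sample_weight R a.2 (g a.1 a.2 i))) /=.
rewrite -(pair_bigA _ (fun (t : 'I_T) v => \prod_i sample_weight R v (g t v i))).
by [].
Qed.

Let set_round g t h tau := if tau == t then h else g tau.

(** Splits by the previous state and the table [h] of round [t]; writing [h] into [g] at [t] extends
    the cylinder one round back. *)
Lemma informed_step t T g I : (t < T)%N ->
  [set w | informed_at t.+1 w = I] `&` samples_agree t.+1 T g =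
  \bigcup_(p in [set p : {set V} * round_samples |
                  push_pull_round (fun v i => p.2 v i) p.1 == I])
    ([set w | informed_at t w = p.1] `&` samples_agree t T (set_round g t p.2)).
Proof.
move=> tT; apply/seteqP; split => [w [wI wg]|w [[J h] /= /eqP roundJ [wJ wg]]].
  exists (informed_at t w, [ffun v => [ffun i => X t v i w]]) => /=.
    rewrite -wI /informed_at /=; apply/eqP; congr push_pull_round.
    by apply/funext => v; apply/funext => i; rewrite !ffunE.
  split=> // tau /andP[ttau tauT] v i; rewrite /set_round; case: eqP => [->|/eqP ne].
    by rewrite !ffunE.
  by apply: wg; rewrite tauT ltn_neqAle eq_sym ne ttau.
split => [|tau /andP[ttau tauT] v i] /=.
  rewrite -roundJ -wJ /informed_at /=; congr push_pull_round.
  apply/funext => v; apply/funext => i.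
  by rewrite (wg t) ?leqnn//= /set_round eqxx.
by rewrite wg ?(ltnW ttau)//= /set_round gtn_eqF.
Qed.

Lemma measurable_informed t I : measurable [set w | informed_at t w = I].
Proof.
elim: t I => [I|t IH I].
  have [->|sI] := eqVneq I [set s]%SET.
    by rewrite (_ : [set w | _] = setT)//; apply/seteqP; split.
  rewrite (_ : [set w | _] = set0)//; apply/seteqP; split => // w /= sE.
  by rewrite -sE eqxx in sI.
pose g0 : nat -> round_samples := fun=> [ffun=> [ffun=> s]].
(* An empty range of rounds imposes nothing, so the decomposition applies to the state event
   alone. *)
have agreeT : samples_agree t.+1 t.+1 g0 = setT.
  by apply/seteqP; split=> // w _ tau; rewrite leqNgt andNb.
rewrite -[X in measurable X]setIT -agreeT informed_step//.
apply: fin_bigcup_measurable; first exact: finite_finset.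
by move=> p _; apply: measurableI => //; exact: measurable_samples_agree.
Qed.

(** The forward equation of the Markov chain of informed sets. *)
Fixpoint state_weight t I : R :=
  if t is t'.+1 then
    \sum_(p : {set V} * round_samples |
            push_pull_round (fun v i => p.2 v i) p.1 == I)
      state_weight t' p.1 * round_weight R p.2
  else (I == [set s]%SET)%:R.

(** The state after [t] rounds is independent of later samples. The induction needs all [g], since
    each step rewrites [g] at round [t]. *)
Lemma prob_informed_samples t T g I : (t <= T)%N ->
  P ([set w | informed_at t w = I] `&` samples_agree t T g) =
  (state_weight t I * \prod_(t <= tau < T) round_weight R (g tau))%:E.
Proof.
elim: t g I => [g I _|t IH g I tT]; rewrite [state_weight _ _]/=.
  have [IE|sI] := eqVneq I [set s]%SET.
    rewrite mul1r -prob_samples_agree; congr (P _); rewrite IE.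
    by rewrite (_ : [set w | _] = setT) ?setTI//; apply/seteqP; split.
  rewrite mul0r (_ : _ `&` _ = set0) ?measure0//.
  by apply/seteqP; split => // w [/= sE _]; rewrite -sE eqxx in sI.
rewrite informed_step// probability_finType_bigcup; last 2 first.
- move=> p _; apply: measurableI; first exact: measurable_informed.
  exact: measurable_samples_agree.
(* The pieces are disjoint: an outcome determines both its state and its table at round [t]. *)
- move=> [J h] [J' h'] w _ _ [/= <- wh] [/= <- wh'].
  congr pair; apply/ffunP => v; apply/ffunP => i.
  have := wh t; have := wh' t; rewrite leqnn tT /set_round eqxx.
  by move=> /(_ isT v i) <- /(_ isT v i) <-.
rewrite (eq_bigr (fun p : {set V} * round_samples => (state_weight t p.1 *
  \prod_(t <= tau < T) round_weight R (set_round g t p.2 tau))%:E)); last first.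
  by move=> p _; apply: IH; exact: ltnW.
rewrite sumEFin mulr_suml; congr EFin; apply: eq_bigr => p _.
rewrite big_ltn// {1}/set_round eqxx mulrA; congr *%R.
apply: eq_big_nat => tau /andP[ttau _].
by rewrite /set_round gtn_eqF.
Qed.

Lemma prob_informed t I : P [set w | informed_at t w = I] = (state_weight t I)%:E.
Proof.
pose g0 : nat -> round_samples := fun=> [ffun=> [ffun=> s]].
have := prob_informed_samples g0 I (leqnn t).
rewrite big_geq// mulr1 => <-; congr (P _).
rewrite (_ : samples_agree _ _ _ = setT) ?setIT//.
by apply/seteqP; split=> // w _ tau; case: ltngtP.
Qed.

Lemma state_weight_ge0 t I : 0 <= state_weight t I.
Proof. by rewrite -lee_fin -prob_informed. Qed.

(** * Decay of the mean potential and Markov's inequality *)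

Lemma sum_state_weight_ratio_le t : (1 < #|V|)%N -> (0 < k)%N ->
  \sum_I state_weight t I * uninformed_ratio R I <= #|V|.-1%:R / k%:R ^+ t.
Proof.
move=> V1 k_gt0; elim: t => [|t IH].
  rewrite /= (bigD1 [set s]%SET)//= big1 ?addr0; last first.
    by move=> I /negPf->; rewrite mul0r.
  rewrite eqxx mul1r /uninformed_ratio cards1 expr0 ler_wpM2r//.
  by rewrite ler_nat -(cardsC [set s]%SET) cards1.
(* Conditioning on the state before the last round, to which the one-round contraction applies. *)
have -> : \sum_I state_weight t.+1 I * uninformed_ratio R I =
    \sum_J state_weight t J * \sum_(h : round_samples) round_weight R h *
      uninformed_ratio R (push_pull_round (fun v i => h v i) J).
  under [RHS]eq_bigr do rewrite mulr_sumr.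
  rewrite pair_bigA /=.
  rewrite [RHS](partition_big (fun p : {set V} * round_samples =>
    push_pull_round (fun v i => p.2 v i) p.1) xpredT)//=.
  apply: eq_bigr => I _; rewrite mulr_suml; apply: eq_bigr => p /eqP->.
  exact/esym/mulrA.
apply: le_trans (_ : _ <= \sum_J state_weight t J * (uninformed_ratio R J / k%:R)) _.
  apply: ler_sum => J _; apply: ler_wpM2l (state_weight_ge0 t J) _ _ _.
  exact: sum_round_uninformed_ratio_le.
under eq_bigr do rewrite mulrA.
rewrite -mulr_suml exprSr invfM mulrA; apply: ler_wpM2r => //.
Qed.

Lemma prob_not_informed_le t : (1 < #|V|)%N -> (0 < k)%N ->
  (P [set w | informed_at t w <> [set: V]%SET] <=
   (#|V|%:R * (#|V|.-1%:R / k%:R ^+ t))%:E)%E.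
Proof.
move=> V1 k_gt0.
(* Requiring [s \in I] excludes the empty set, whose potential is 0 by default and would defeat the
   lower bound [1 / n]. *)
pose Q : pred {set V} := fun I => (I != [set: V]%SET) && (s \in I).
rewrite (_ : [set w | _] =
    \bigcup_(I in [set I | Q I]) [set w | informed_at t w = I]); last first.
  apply/seteqP; split => [w /eqP wT|w [I /andP[/eqP IT _] /= ->]//].
  exists (informed_at t w) => //=; rewrite /Q wT /= /informed_at {wT}.
  by elim: t => [|t IH] /=; rewrite !inE// IH.
rewrite probability_finType_bigcup; last 2 first.
- by move=> I _; exact: measurable_informed.
- by move=> I J w _ _ /= -> ->.
rewrite (eq_bigr (fun I => (state_weight t I)%:E)); last first.
  by move=> I _; exact: prob_informed.
rewrite sumEFin lee_fin.
apply: le_trans (ler_wpM2l (ler0n _ _) (sum_state_weight_ratio_le t V1 k_gt0)).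
rewrite mulr_sumr [leLHS]big_mkcond /=; apply: ler_sum => I _.
have sw := state_weight_ge0 t I.
have ratio_ge0 : 0 <= uninformed_ratio R I by rewrite divr_ge0.
case: ifPn => [/andP[IT sI]|_]; last by rewrite !mulr_ge0.
rewrite mulrCA ler_peMr// /uninformed_ratio mulrA.
have I_gt0 : (0 < #|I|)%N by apply/card_gt0P; exists s.
rewrite ler_pdivlMr ?ltr0n// mul1r -natrM ler_nat.
apply: leq_trans (max_card I) _; rewrite leq_pmulr// lt0n cards_eq0.
by apply: contra IT => /eqP CI; rewrite -(finset.setCK I) CI finset.setC0.
Qed.

End Protocol.

(** * Spreading time and the final bound *)

Lemma informed_homo (V : finType) (k : nat) (smp : nat -> V -> 'I_k -> V) (s : V)
    (t T : nat) :
  (t <= T)%N -> informed smp s t \subset informed smp s T.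
Proof.
move=> /subnK <-; elim: (T - t)%N => [//|m IH].
rewrite addSn; apply: fintype.subset_trans IH _; apply/fintype.subsetP => v /= vI.
by rewrite inE vI.
Qed.

(** Completion persists, so if it fails at [T] every completion time is at least [T + 1]; this
    bounds the infimum even when it is infinite. *)
Lemma spreading_time_le (R : realType) (V : finType) (k : nat)
    (smp : nat -> V -> 'I_k -> V) (s : V) (T : nat) :
  (spreading_time R smp s <= T%:R%:E)%E <-> informed smp s T = [set: V]%SET.
Proof.
split=> [leT|sT]; last by apply: ereal_inf_lbound; exists T.
apply/eqP; apply: contraT => sT.
have : (T.+1%:R%:E <= spreading_time R smp s)%E.
  apply/ereal_infP => _ [t /= st <-]; rewrite lee_fin ler_nat ltnNge.
  apply: contra sT => /(informed_homo smp s); rewrite st => VT.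
  by rewrite finset.eqEsubset finset.subsetT.
by move=> /le_trans/(_ leT); rewrite lee_fin ler_nat ltnn.
Qed.

(* The number of rounds is an integer, at least 1 when n > 1, so the bound
   C * log_k n is rounded up: it is below 1 once k > n ^ C.  For k <= n one has
   log_k n >= 1, so rounding is absorbed in the constant C. *)
Theorem lemma2p2 (R : realType) (c : R) (hc : 0 < c) :
  exists2 C : R, 0 < C &
    forall (n k : nat), (1 < n)%N -> (2 <= k)%N ->
    forall (d : measure_display) (Omega : measurableType d)
           (P : probability Omega R)
           (X : nat -> 'I_n -> 'I_k -> Omega -> 'I_n) (s : 'I_n),
      neighbor_samples P (@complete_graph 'I_n) X ->
      ((1 - n%:R `^ (- c))%:E <=
       P [set w | spreading_time R (fun t u i => X t u i w) s <=
                  (Num.ceil (C * (ln n%:R / ln k%:R)))%:~R%:E])%E.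
Proof.
(* One factor [n] comes from Markov's inequality, one from the initial potential, and [c] from the
   target probability. *)
exists (2 + c) => [|n k n_gt1 k_gt1 d Omega P X s X_samples]; first by rewrite addr_gt0.
set x := _ * (_ / _); pose N := `|Num.ceil x|%N.
have ln_n_gt0 : 0 < ln (n%:R : R) by rewrite ln_gt0// ltr1n.
have ln_k_gt0 : 0 < ln (k%:R : R) by rewrite ln_gt0// ltr1n.
have x_ge0 : 0 <= x by rewrite mulr_ge0 ?divr_ge0 ?ltW ?addr_gt0.
have NE : (Num.ceil x)%:~R = N%:R :> R.
  by rewrite /N natr_absz ger0_norm// ceil_ge0 (lt_le_trans _ x_ge0)// oppr_lt0.
(* In logarithms, this is [(2 + c) * ln n <= N * ln k], which rounding up ensures. *)
have kN : n%:R `^ (2 + c) <= (k%:R : R) ^+ N.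
  rewrite -powR_mulrn ?ler0n// /powR !gt_eqF ?ltr0n ?(ltnW n_gt1) ?(ltnW k_gt1)//.
  by rewrite ler_expR -ler_pdivrMr// -mulrA -NE ceil_ge.
rewrite NE (_ : [set w | _] =
    [set w | informed (fun t u i => X t u i w) s N = [set: 'I_n]%SET]); last first.
  by apply/seteqP; split => w /= /spreading_time_le.
have mN := measurable_informed s X_samples N [set: 'I_n]%SET.
have := prob_not_informed_le s X_samples N; rewrite card_ord.
set A : set Omega := [set w | _ = _] in mN *.
rewrite (_ : [set w | _ <> _] = ~` A)// probability_setC//.
have -> : P A = (fine (P A))%:E by rewrite fineK// fin_num_measure.
move=> /(_ n_gt1 (ltnW k_gt1)); rewrite -EFinB !lee_fin => le_fail.
rewrite lerBlDr -lerBlDl; apply: le_trans le_fail _.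
have n_gt0 : (0 : R) < n%:R by rewrite ltr0n ltnW.
rewrite mulrA ler_pdivrMr; last by rewrite exprn_gt0// ltr0n ltnW.
(* It remains to compare [n * (n - 1)] with [n ^ (-c) * n ^ (2 + c) = n ^ 2]. *)
apply: le_trans (ler_wpM2l (powR_ge0 _ _) kN).
rewrite -powRD ?(gt_eqF n_gt0) ?implybT// addrCA addNr addr0 (powR_mulrn 2) ?ler0n//.
by rewrite expr2 ler_wpM2l// ler_nat leq_pred.
Qed.
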